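(* Let $\mathcal{F}$ be a quantity of interest map and $V\subset X_{\mathcal{N}}$ a set containing all the gPC coefficients $\widehat{u}^{\mathcal{N}}_m,\widehat{u}^N_m$ ($1\le m\le M$) defined in the context, such that for some map $\theta_{\mathcal{F}}:V\to X_{\mathcal{N}}$, (i) $\mathcal{F}\left[\sum_{m=1}^M v_m(\boldsymbol{x})\Phi_m(\boldsymbol{\mu})\right]=\sum_{m=1}^M\theta_{\mathcal{F}}(v_m)\,\mathcal{F}[\Phi_m(\boldsymbol{\mu})]$ for all $v_1,\dots,v_M\in V$, where $\mathcal{F}[\Phi_m(\boldsymbol{\mu})]\in\mathbb{R}$; (ii) $\|\theta_{\mathcal{F}}(v)-\theta_{\mathcal{F}}(w)\|_{X_{\mathcal{N}}}\le C_{\mathrm{Lip}}\|v-w\|_{X_{\mathcal{N}}}$ for all $v,w\in V$. Assume the a posteriori estimate satisfies $\Delta_N(\boldsymbol{\mu}^q)\ge\|u^{\mathcal{N}}(\cdot,\boldsymbol{\mu}^q)-u^N(\cdot,\boldsymbol{\mu}^q)\|_{X_{\mathcal{N}}}$ for $q=1,\dots,Q$. Then the gPC approximation $u^N_M$ output by the hybrid algorithm described in the context, with $N$ the number of snapshots in the reduced basis it uses, satisfies $$\left\|\mathcal{F}[u^N_M]-\mathcal{F}[u^{\mathcal{N}}_M]\right\|_{X_{\mathcal{N}}}\le C_{\mathrm{Lip}}\,\varepsilon,$$ where $$\varepsilon=C_{Q,M}\sqrt{\frac1Q\sum_{q=1}^Q\left(\Delta^w_N(\boldsymbol{\mu}^q)\right)^2},\qquad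 C_{Q,M}=\sum_{m=1}^M\sqrt{\sum_{q=1}^Q|w_q|\Phi_m^2(\boldsymbol{\mu}^q)}\;\left|\mathcal{F}[\Phi_m(\boldsymbol{\mu})]\right|.$$ In particular, if the algorithm terminates successfully with user-prescribed tolerance $\varepsilon_{\mathrm{tol}}$, then $\varepsilon\le\varepsilon_{\mathrm{tol}}$.
   Context: Parameters: $\boldsymbol{\mu}=(\mu_1,\dots,\mu_K)$ is a random vector with mutually independent components, $\mu_i$ having image $\Gamma_i\subset\mathbb{R}$, probability density $\rho_i$ and finite moments of all orders; $\boldsymbol{\Gamma}=\Gamma_1\times\cdots\times\Gamma_K$ and $\rho(\boldsymbol{\mu})=\prod_i\rho_i(\mu_i)$. For each $i$, $\{\phi^{(i)}_n\}_{n\ge0}$ are the orthonormal polynomials for $\rho_i$ ($\deg\phi^{(i)}_n=n$), and $\Phi_\alpha(\boldsymbol{\mu})=\prod_{k=1}^K\phi^{(k)}_{\alpha_k}(\mu_k)$ for $\alpha\in\mathbb{N}_0^K$. The functions $\Phi_1,\dots,\Phi_M$, with $M=\binom{K+P}{K}$, enumerate the $\Phi_\alpha$ with $|\alpha|=\sum_k\alpha_k\le P$, in an ordering nondecreasing in $|\alpha|$. $\{\boldsymbol{\mu}^q,w_q\}_{q=1}^Q$ is a quadrature rule with real (possibly negative) weights, meant to approximate $\int_{\boldsymbol{\Gamma}}f\rho\,d\boldsymbol{\mu}\approx\sum_q w_q f(\boldsymbol{\mu}^q)$; the training set is $\Xi=\{\boldsymbol{\mu}^q\}_{q=1}^Q$.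 Truth solution: $X_{\mathcal{N}}$ is a real Hilbert space of dimension $\mathcal{N}$ (a discretized space of functions of the spatial variable $\boldsymbol{x}\in D$) with norm $\|\cdot\|_{X_{\mathcal{N}}}$. For each $\boldsymbol{\mu}\in\boldsymbol{\Gamma}$, $u^{\mathcal{N}}(\cdot,\boldsymbol{\mu})\in X_{\mathcal{N}}$ is the unique solution of a discretized linear PDE $\mathcal{L}^{\mathcal{N}}(\boldsymbol{\mu})u^{\mathcal{N}}(\cdot,\boldsymbol{\mu})=f^{\mathcal{N}}(\boldsymbol{\mu})$, with $\mathcal{L}^{\mathcal{N}}(\boldsymbol{\mu})$ an invertible linear operator (identified with its matrix). Reduced basis approximation: given snapshots at $\boldsymbol{\nu}^1,\dots,\boldsymbol{\nu}^k\in\Xi$, set $X^k=\mathrm{span}\{u^{\mathcal{N}}(\cdot,\boldsymbol{\nu}^j)\}_{j=1}^k\subset X_{\mathcal{N}}$. For each $\boldsymbol{\mu}$, $u^k(\cdot,\boldsymbol{\mu})=\sum_{j=1}^k c_j(\boldsymbol{\mu})u^{\mathcal{N}}(\cdot,\boldsymbol{\nu}^j)\in X^k$, with real $c_j(\boldsymbol{\mu})$ determined by $\mathcal{P}\big[\sum_j c_j(\boldsymbol{\mu})\mathcal{L}^{\mathcal{N}}(\boldsymbol{\mu})u^{\mathcal{N}}(\cdot,\boldsymbol{\nu}^j)\big]=\mathcal{P}[f^{\mathcal{N}}(\boldsymbol{\mu})]$ for a chosen projection operator $\mathcal{P}$ (e.g. least squares). A posteriori estimates: $\Delta_k(\boldsymbol{\mu})=\|R_k(\cdot,\boldsymbol{\mu})\|_{X_{\mathcal{N}}}/\sqrt{\beta_{LB}(\boldsymbol{\mu})}$,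 where $R_k(\cdot,\boldsymbol{\mu})$ is (the Riesz representation of) the residual $f^{\mathcal{N}}(\boldsymbol{\mu})-\mathcal{L}^{\mathcal{N}}(\boldsymbol{\mu})u^k(\cdot,\boldsymbol{\mu})$ and $0<\beta_{LB}(\boldsymbol{\mu})\le\min_{v\ne0}\frac{v^T\mathcal{L}^{\mathcal{N}}(\boldsymbol{\mu})^T\mathcal{L}^{\mathcal{N}}(\boldsymbol{\mu})v}{\|v\|^2_{X_{\mathcal{N}}}}$. The standing assumption is that this estimate is rigorous (it bounds the error in $\|\cdot\|_{X_{\mathcal{N}}}$ on $\Xi$); this is the only property of it that matters for the claim. The weighted estimate is $\Delta^w_k(\boldsymbol{\mu}^q)=\Delta_k(\boldsymbol{\mu}^q)\sqrt{Q|w_q|}$. gPC approximations: $\widehat{u}^{\mathcal{N}}_m=\sum_{q=1}^Q w_q u^{\mathcal{N}}(\cdot,\boldsymbol{\mu}^q)\Phi_m(\boldsymbol{\mu}^q)$, $\widehat{u}^{N}_m=\sum_{q=1}^Q w_q u^{N}(\cdot,\boldsymbol{\mu}^q)\Phi_m(\boldsymbol{\mu}^q)$, $u^{\mathcal{N}}_M=\sum_{m=1}^M\widehat{u}^{\mathcal{N}}_m\Phi_m$, $u^N_M=\sum_{m=1}^M\widehat{u}^N_m\Phi_m$. Quantity of interest: $\mathcal{F}$ maps $M$-term gPC expansions $\sum_m v_m(\boldsymbol{x})\Phi_m(\boldsymbol{\mu})$ with $v_m\in V$ to elements of $X_{\mathcal{N}}$, and scalar polynomials $\Phi_m(\boldsymbol{\mu})$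 to real numbers. Hybrid algorithm, with input tolerance $\varepsilon_{\mathrm{tol}}>0$. Offline (greedy) stage: choose $\boldsymbol{\nu}^1\in\Xi$ arbitrarily. With $k$ snapshots, compute $\Delta^w_k(\boldsymbol{\mu})$ for all $\boldsymbol{\mu}\in\Xi$ and $\varepsilon=C_{Q,M}\sqrt{\frac1Q\sum_{q=1}^Q(\Delta^w_k(\boldsymbol{\mu}^q))^2}$. If $\varepsilon>\varepsilon_{\mathrm{tol}}$, add the snapshot at $\boldsymbol{\nu}^{k+1}\in\operatorname{argmax}_{\boldsymbol{\mu}\in\Xi}\Delta^w_k(\boldsymbol{\mu})$ and repeat; the stage terminates successfully when $\varepsilon\le\varepsilon_{\mathrm{tol}}$, and then $N$ is the current number of snapshots. Online stage: compute the coefficients $\widehat{u}^N_m$, $1\le m\le M$, from $u^N$ and output $u^N_M$ (or $\mathcal{F}[u^N_M]$). *)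

(* Defs.v *)
From mathcomp Require Import all_boot all_order all_algebra.
From mathcomp Require Import all_classical all_reals all_analysis.

Set Implicit Arguments.
Unset Strict Implicit.
Unset Printing Implicit Defensive.

Import Order.TTheory GRing.Theory Num.Theory.
Import numFieldNormedType.Exports.

Local Open Scope classical_set_scope.
Local Open Scope ring_scope.

Definition mutually_independent (R : realType) (K : nat) (d : measure_display)
    (Omega : measurableType d) (Pr : probability Omega R)
    (mu : 'I_K -> {RV Pr >-> R}) : Prop :=
  forall (J : {set 'I_K}) (A : 'I_K -> set R),
    (forall i, measurable (A i)) ->
    Pr (\bigcap_(i in [set` J]) (mu i @^-1` A i)) =
    (\prod_(i in J) Pr (mu i @^-1` A i))%E.

Definition is_density (R : realType) (d : measure_display)
    (Omega : measurableType d) (Pr : probability Omega R)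
    (X : {RV Pr >-> R}) (rho : R -> R) : Prop :=
  [/\ measurable_fun setT rho,
      forall x, 0 <= rho x &
      forall A : set R, measurable A ->
        (distribution Pr X A = \int[lebesgue_measure]_(x in A) (rho x)%:E)%E].

Definition finite_moments (R : realType) (d : measure_display)
    (Omega : measurableType d) (Pr : probability Omega R)
    (X : {RV Pr >-> R}) : Prop :=
  forall p : nat, Pr.-integrable setT (fun t => (X t ^+ p)%:E).

(* Gamma = Gamma_1 x ... x Gamma_K, where Gamma_i is the image of mu_i. *)
Definition param_domain (R : realType) (K : nat) (d : measure_display)
    (Omega : measurableType d) (Pr : probability Omega R)
    (mu : 'I_K -> {RV Pr >-> R}) : set 'rV[R]_K :=
  [set x | forall i, range (mu i) (x 0 i)].

(* [size p = n.+1] says that p has degree n.  The integral is over the whole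
   line because rho is a density of the law of mu_i on the line. *)
Definition orthonormal_polys (R : realType) (rho : R -> R)
    (phi : nat -> {poly R}) : Prop :=
  (forall n, size (phi n) = n.+1) /\
  (forall n m, (\int[lebesgue_measure]_x
      ((phi n).[x] * (phi m).[x] * rho x)%:E = ((n == m)%:R : R)%:E)%E).

Definition mdeg (K : nat) (a : {ffun 'I_K -> nat}) : nat := (\sum_k a k)%N.

Definition gpc_dim (K P : nat) : nat := 'C(K + P, K).

Definition graded_enumeration (K P : nat)
    (alpha : 'I_(gpc_dim K P) -> {ffun 'I_K -> nat}) : Prop :=
  [/\ injective alpha,
      forall a, (exists m, alpha m = a) <-> (mdeg a <= P)%N &
      forall m m' : 'I_(gpc_dim K P), (m <= m')%N ->
        (mdeg (alpha m) <= mdeg (alpha m'))%N].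

Definition gpc_basis (R : realType) (K : nat) (phi : 'I_K -> nat -> {poly R})
    (a : {ffun 'I_K -> nat}) (x : 'rV[R]_K) : R :=
  \prod_k (phi k (a k)).[x 0 k].

Definition gpc_expansion (R : realType) (T : Type) (X : lmodType R) (M : nat)
    (Phi : 'I_M -> T -> R) (v : 'I_M -> X) : T -> X :=
  fun x => \sum_m Phi m x *: v m.

Definition gpc_coef (R : realType) (T : Type) (X : lmodType R) (Q M : nat)
    (node : 'I_Q -> T) (w : 'I_Q -> R) (Phi : 'I_M -> T -> R)
    (u : T -> X) (m : 'I_M) : X :=
  \sum_q (w q * Phi m (node q)) *: u (node q).

(* A finite-dimensional real Hilbert space is a [vectType] with a positive
   definite symmetric form. *)
Definition hnorm (R : realType) (X : vectType R) (ip : {dot X for idfun})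
    (v : X) : R := Num.sqrt (ip v v).

Definition coords (R : realType) (X : vectType R) (n : nat) (e : n.-tuple X)
    (v : X) : 'cV[R]_n := \col_i coord e i v.

(* A column r of R^n acts on X as the functional v |-> r^T v, with v written in
   the discretization basis e; this is its Riesz representative in X. *)
Definition riesz_rep (R : realType) (X : vectType R) (ip : {dot X for idfun})
    (n : nat) (e : n.-tuple X) (r : 'cV[R]_n) : X :=
  xget 0 [set z | forall v, ip z v = (r^T *m coords e v) 0 0].

Lemma riesz_repP (R : realType) (X : vectType R) (ip : {dot X for idfun})
    (n : nat) (e : n.-tuple X) (r : 'cV[R]_n) : basis_of fullv e ->
  forall v, ip (riesz_rep ip e r) v = (r^T *m coords e v) 0 0.
Proof.
move=> eB.
pose A : 'M[R]_n := \matrix_(i, j) ip e`_i e`_j.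
have ipE (x : 'I_n -> R) v : ip (\sum_i x i *: e`_i) v
    = \sum_i x i * ip e`_i v.
  by rewrite linear_sumlz; apply: eq_bigr => i _; rewrite linearZl_LR.
have vE v : v = \sum_j coord e j v *: e`_j.
  exact: (coord_basis eB (memvf v)).
have ipA (x : 'rV[R]_n) v :
    ip (\sum_i x 0 i *: e`_i) v = (x *m A *m coords e v) 0 0.
  rewrite -mulmxA mxE ipE; apply: eq_bigr => i _; congr (_ * _).
  rewrite {1}(vE v) linear_sumr mxE; apply: eq_bigr => j _.
  by rewrite linearZr_LR !mxE mulrC.
have Au : A \in unitmx.
  rewrite -row_free_unit -kermx_eq0; apply/rowV0P => x /sub_kermxP xA0.
  have x0 : \sum_i x 0 i *: e`_i = 0.
    apply/eqP; apply/negPn/negP => /(neq0_dnorm_gt0 (s:=ip)).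
    by rewrite ipA xA0 mul0mx mxE ltxx.
  apply/rowP => i; rewrite mxE.
  have /freeP := basis_free eB.
  by apply.
have rP : [set z | forall v, ip z v = (r^T *m coords e v) 0 0]
    (\sum_i (r^T *m invmx A) 0 i *: e`_i) by move=> v; rewrite ipA mulmxKV.
exact: (xgetPex 0 (ex_intro _ _ rP)).
Qed.

Definition rayleigh (R : realType) (X : vectType R) (ip : {dot X for idfun})
    (n : nat) (e : n.-tuple X) (A : 'M[R]_n) (v : X) : R :=
  ((coords e v)^T *m A^T *m A *m coords e v) 0 0 / hnorm ip v ^+ 2.

(* A reduced basis is given by the list s of the quadrature indices of its
   snapshots; the j-th snapshot parameter is node s_j. *)
Definition rb_solution (R : realType) (T : Type) (X : vectType R) (Q : nat)
    (node : 'I_Q -> T) (u : T -> X) (c : seq 'I_Q -> T -> nat -> R)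
    (s : seq 'I_Q) (x : T) : X :=
  \sum_(j < size s) c s x j *: u (node (tnth (in_tuple s) j)).

Definition rb_equation (R : realType) (T : Type) (X : vectType R) (Q n : nat)
    (e : n.-tuple X) (node : 'I_Q -> T) (u : T -> X)
    (L : T -> 'M[R]_n) (f : T -> 'cV[R]_n)
    (proj : seq 'I_Q -> T -> 'M[R]_n) (c : seq 'I_Q -> T -> nat -> R)
    (s : seq 'I_Q) (x : T) : Prop :=
  proj s x *m (\sum_(j < size s) c s x j *:
    (L x *m coords e (u (node (tnth (in_tuple s) j))))) = proj s x *m f x.

Definition error_estimate (R : realType) (T : Type) (X : vectType R)
    (ip : {dot X for idfun}) (n : nat) (e : n.-tuple X)
    (L : T -> 'M[R]_n) (f : T -> 'cV[R]_n) (beta : T -> R) (uk : T -> X)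
    (x : T) : R :=
  hnorm ip (riesz_rep ip e (f x - L x *m coords e (uk x))) / Num.sqrt (beta x).

Definition weighted_estimate (R : realType) (T : Type) (Q : nat)
    (node : 'I_Q -> T) (w : 'I_Q -> R) (Delta : T -> R) (q : 'I_Q) : R :=
  Delta (node q) * Num.sqrt (Q%:R * `|w q|).

Definition gpc_constant (R : realType) (T : Type) (Q M : nat)
    (node : 'I_Q -> T) (w : 'I_Q -> R) (Phi : 'I_M -> T -> R)
    (Fscal : (T -> R) -> R) : R :=
  \sum_m Num.sqrt (\sum_q `|w q| * Phi m (node q) ^+ 2) * `|Fscal (Phi m)|.

Definition greedy_error (R : realType) (Q : nat) (C : R)
    (Deltaw : 'I_Q -> R) : R :=
  C * Num.sqrt (Q%:R^-1 * \sum_q Deltaw q ^+ 2).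

(* The snapshot lists that the greedy stage can produce, from the weighted
   estimates [Deltaw s] and the errors [err s] attached to each list s. *)
Inductive greedy_reachable (R : realType) (Q : nat)
    (Deltaw : seq 'I_Q -> 'I_Q -> R) (err : seq 'I_Q -> R) (tol : R) :
    seq 'I_Q -> Prop :=
| greedy_start q : greedy_reachable Deltaw err tol [:: q]
| greedy_step s q : greedy_reachable Deltaw err tol s -> tol < err s ->
    (forall q', Deltaw s q' <= Deltaw s q) ->
    greedy_reachable Deltaw err tol (rcons s q).

Definition greedy_terminates (R : realType) (Q : nat)
    (Deltaw : seq 'I_Q -> 'I_Q -> R) (err : seq 'I_Q -> R) (tol : R)
    (s : seq 'I_Q) : Prop :=
  greedy_reachable Deltaw err tol s /\ err s <= tol.

(* Main.v *)
(* Since F acts on expansions coefficientwise through the Lipschitz map theta,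
   only the errors of the gPC coefficients matter.  For each of them,
   writing |w_q| = sqrt|w_q| * sqrt|w_q| and applying the Cauchy-Schwarz
   inequality to sum_q |w_q| |Phi_m(mu^q)| Delta(mu^q) splits the error into the
   m-th square root of C_{Q,M} and sqrt(sum_q |w_q| Delta(mu^q)^2), which is the
   root mean square of the weighted estimates. *)
Require Import Defs.
From mathcomp Require Import all_boot all_order all_algebra.
From mathcomp Require Import all_classical all_reals all_analysis.
From mathcomp Require Import ring.

Set Implicit Arguments.
Unset Strict Implicit.
Unset Printing Implicit Defensive.

Import Order.TTheory GRing.Theory Num.Theory.
Import numFieldNormedType.Exports.

Local Open Scope classical_set_scope.
Local Open Scope ring_scope.

Lemma dot_ge0 (R : rcfType) (X : lmodType R) (ip : {dot X for idfun}) (x : X) :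
  0 <= ip x x.
Proof.
by have [->|/neq0_dnorm_gt0/ltW //] := eqVneq x 0; rewrite linear0l.
Qed.

(** For [v != 0], the part of [u] orthogonal to [v] has nonnegative square; scaling it by [ip v v]
    avoids any division. *)
Lemma dot_CauchySchwarz (R : rcfType) (X : lmodType R) (ip : {dot X for idfun})
    (u v : X) : ip u v ^+ 2 <= ip u u * ip v v.
Proof.
have ip0 := dot_ge0 ip.
have [->|v0] := eqVneq v 0; first by rewrite !linear0r expr0n.
have vv0 : 0 < ip v v by exact: neq0_dnorm_gt0.
have ipC : ip v u = ip u v by rewrite hermC mul1r.
have := ip0 (ip v v *: u - ip u v *: v).
rewrite linearBl !linearBr /= !linearZl_LR /= !linearZr_LR /= ipC.
set a := ip u u; set b := ip u v; set c := ip v v in vv0 *.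
rewrite (_ : _ - _ = c * (a * c - b ^+ 2)); last by rewrite /GRing.scale /=; ring.
by rewrite pmulr_rge0// subr_ge0.
Qed.

Section HilbertNorm.
Variables (R : realType) (X : vectType R) (ip : {dot X for idfun}).

Lemma hnormD_le (u v : X) : hnorm ip (u + v) <= hnorm ip u + hnorm ip v.
Proof.
have ip0 := dot_ge0 ip.
have uv : ip u v <= hnorm ip u * hnorm ip v.
  rewrite -sqrtrM//; apply: (le_trans (ler_norm _)).
  by rewrite -sqrtr_sqr ler_wsqrtr// dot_CauchySchwarz.
rewrite -(ler_pXn2r (n := 2))// ?nnegrE ?addr_ge0 ?sqrtr_ge0//.
(* Here [hnormD] expands the form [ip] at [u + v], not the norm [hnorm]; after squaring, the two
   sides differ only in the cross term, which [uv] bounds. *)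
rewrite sqr_sqrtr// hnormD mul1r /= sqrrD !sqr_sqrtr// [leRHS]addrAC.
by rewrite lerD2l -mulr2n lerMn2r.
Qed.

Lemma hnormZ a (u : X) : hnorm ip (a *: u) = `|a| * hnorm ip u.
Proof.
rewrite /hnorm linearZl_LR linearZr_LR /= mulrA -expr2 sqrtrM ?sqr_ge0//.
by rewrite sqrtr_sqr.
Qed.

Lemma hnorm_sum (I : Type) (r : seq I) (P : pred I) (F : I -> X) :
  hnorm ip (\sum_(i <- r | P i) F i) <= \sum_(i <- r | P i) hnorm ip (F i).
Proof.
elim/big_ind2 : _ => //; first by rewrite /hnorm linear0l sqrtr0.
by move=> x a y b xa yb; rewrite (le_trans (hnormD_le _ _))// lerD.
Qed.

Lemma hnorm_distC (u v : X) : hnorm ip (u - v) = hnorm ip (v - u).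
Proof. by rewrite /hnorm -opprB hnormN. Qed.

End HilbertNorm.

(** This follows from Lagrange's identity: the gap [A * B - S ^+ 2] is half a double sum of squares,
    the half because each unordered pair of indices is counted twice. *)
Lemma sum_CauchySchwarz (R : rcfType) (I : finType) (a b : I -> R) :
  \sum_i a i * b i <= Num.sqrt (\sum_i a i ^+ 2) * Num.sqrt (\sum_i b i ^+ 2).
Proof.
set A := \sum_i a i ^+ 2; set B := \sum_i b i ^+ 2; set S := \sum_i _.
have lagrange : \sum_i \sum_j (a i * b j - a j * b i) ^+ 2
    = (A * B - S ^+ 2) *+ 2.
  have AB : A * B = \sum_i \sum_j a i ^+ 2 * b j ^+ 2 by rewrite big_distrlr.
  (* The index-swapped form of [AB] accounts for the second square in the expansion of the
     summand. *)
  have BA : A * B = \sum_i \sum_j a j ^+ 2 * b i ^+ 2.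
    by rewrite AB exchange_big.
  have SS : S ^+ 2 = \sum_i \sum_j (a i * b i) * (a j * b j).
    by rewrite expr2 big_distrlr.
  rewrite mulrnBl mulr2n {1}AB BA SS -big_split -sumrMnl -sumrB /=.
  apply: eq_bigr => i _; rewrite -big_split -sumrMnl -sumrB /=.
  by apply: eq_bigr => j _; ring.
rewrite -sqrtrM; last by apply: sumr_ge0 => i _; exact: sqr_ge0.
apply: (le_trans (ler_norm _)); rewrite -sqrtr_sqr ler_wsqrtr//.
rewrite -subr_ge0 -(pmulrn_lge0 _ (n := 2))// -lagrange.
by do 2!apply: sumr_ge0 => ? _; exact: sqr_ge0.
Qed.

Section GpcError.
Variables (R : realType) (T : Type) (X : vectType R) (ip : {dot X for idfun}).
Variables (Q M : nat) (node : 'I_Q -> T) (w : 'I_Q -> R) (Phi : 'I_M -> T -> R).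

(** Both coefficients use the same quadrature rule, so their difference is that rule applied to
    [u - v], which is sampled only at the nodes. *)
Lemma gpc_coef_error (u v : T -> X) (Delta : T -> R) (m : 'I_M) :
  (forall q, hnorm ip (u (node q) - v (node q)) <= Delta (node q)) ->
  hnorm ip (gpc_coef node w Phi u m - gpc_coef node w Phi v m) <=
  Num.sqrt (\sum_q `|w q| * Phi m (node q) ^+ 2) *
  Num.sqrt (\sum_q `|w q| * Delta (node q) ^+ 2).
Proof.
move=> uv; rewrite /gpc_coef -sumrB; apply: (le_trans (hnorm_sum _ _ _ _)).
pose a q := Num.sqrt `|w q| * `|Phi m (node q)|.
pose b q := Num.sqrt `|w q| * Delta (node q).
have aE : \sum_q `|w q| * Phi m (node q) ^+ 2 = \sum_q a q ^+ 2.
  by apply: eq_bigr => q _; rewrite exprMn sqr_sqrtr// real_normK ?num_real.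
have bE : \sum_q `|w q| * Delta (node q) ^+ 2 = \sum_q b q ^+ 2.
  by apply: eq_bigr => q _; rewrite exprMn sqr_sqrtr.
rewrite aE bE; apply: le_trans (sum_CauchySchwarz _ _); apply: ler_sum => q _.
rewrite -scalerBr hnormZ [leRHS]mulrACA -expr2 sqr_sqrtr// mulrA -normrM.
by rewrite ler_wpM2l.
Qed.

(** The factor [Q] under the root in the weighted estimate is there to cancel the [1/Q] of the
    mean. *)
Lemma sum_weighted_estimate (Delta : T -> R) :
  Q%:R^-1 * (\sum_q weighted_estimate node w Delta q ^+ 2) =
  \sum_q `|w q| * Delta (node q) ^+ 2.
Proof.
rewrite mulr_sumr; apply: eq_bigr => q _.
(* The index [q] itself witnesses [0 < Q]; for [Q = 0] both sums are empty. *)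
have Q0 : Q%:R != 0 :> R by rewrite pnatr_eq0 -lt0n (leq_ltn_trans _ (ltn_ord q)).
by rewrite exprMn sqr_sqrtr ?mulr_ge0// mulrCA mulKf// mulrC.
Qed.

End GpcError.

Theorem corollary4
    (R : realType) (K P Q n : nat)
    (d : measure_display) (Omega : measurableType d) (Pr : probability Omega R)
    (mu : 'I_K -> {RV Pr >-> R}) (rho : 'I_K -> R -> R)
    (phi : 'I_K -> nat -> {poly R})
    (alpha : 'I_(gpc_dim K P) -> {ffun 'I_K -> nat})
    (node : 'I_Q -> 'rV[R]_K) (w : 'I_Q -> R)
    (X : vectType R) (ip : {dot X for idfun}) (e : n.-tuple X)
    (L : 'rV[R]_K -> 'M[R]_n) (f : 'rV[R]_K -> 'cV[R]_n) (u : 'rV[R]_K -> X)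
    (beta : 'rV[R]_K -> R)
    (proj : seq 'I_Q -> 'rV[R]_K -> 'M[R]_n)
    (c : seq 'I_Q -> 'rV[R]_K -> nat -> R)
    (Fexp : ('rV[R]_K -> X) -> X) (Fscal : ('rV[R]_K -> R) -> R)
    (V : set X) (theta : X -> X) (CLip tol : R) (s : seq 'I_Q) :
  let Gamma := param_domain mu in
  let Phi := fun m => gpc_basis phi (alpha m) in
  let uRB := rb_solution node u c in
  let Delta := fun s' => error_estimate ip e L f beta (uRB s') in
  let Deltaw := fun s' => weighted_estimate node w (Delta s') in
  let CQM := gpc_constant node w Phi Fscal in
  let eps := fun s' => greedy_error CQM (Deltaw s') in
  let uM := gpc_expansion Phi (gpc_coef node w Phi u) in
  let uNM := gpc_expansion Phi (gpc_coef node w Phi (uRB s)) in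
  mutually_independent mu ->
  (forall i, is_density (mu i) (rho i)) ->
  (forall i, finite_moments (mu i)) ->
  (forall i, orthonormal_polys (rho i) (phi i)) ->
  graded_enumeration alpha ->
  (forall q, Gamma (node q)) ->
  basis_of fullv e ->
  (forall x, Gamma x -> L x \in unitmx) ->
  (forall x, Gamma x -> L x *m coords e (u x) = f x) ->
  (forall x, Gamma x -> 0 < beta x) ->
  (forall x v, Gamma x -> v != 0 -> beta x <= rayleigh ip e (L x) v) ->
  0 < tol ->
  greedy_reachable Deltaw eps tol s ->
  (forall s' x, greedy_reachable Deltaw eps tol s' -> Gamma x ->
     proj s' x *m proj s' x = proj s' x /\
     rb_equation e node u L f proj c s' x) ->
  (forall m, V (gpc_coef node w Phi u m)) ->
  (forall m, V (gpc_coef node w Phi (uRB s) m)) ->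
  (forall v : 'I_(gpc_dim K P) -> X, (forall m, V (v m)) ->
     Fexp (gpc_expansion Phi v) = \sum_m Fscal (Phi m) *: theta (v m)) ->
  0 <= CLip ->
  (forall v v', V v -> V v' ->
     hnorm ip (theta v - theta v') <= CLip * hnorm ip (v - v')) ->
  (forall q, hnorm ip (u (node q) - uRB s (node q)) <= Delta s (node q)) ->
  hnorm ip (Fexp uNM - Fexp uM) <= CLip * eps s /\
  (greedy_terminates Deltaw eps tol s -> eps s <= tol).
Proof.
move=> Gamma Phi uRB Delta Deltaw CQM eps uM uNM.
move=> _ _ _ _ _ _ _ _ _ _ _ _ _ _ VuM VuNM FexpE CLip0 thetaL est.
split; last by case.
have {}est q : hnorm ip (uRB s (node q) - u (node q)) <= Delta s (node q).
  by rewrite hnorm_distC.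
rewrite !FexpE// -sumrB; apply: (le_trans (hnorm_sum _ _ _ _)).
(* The root mean square is common to all [m]; distributing it and [CLip] over the sum defining [CQM]
   leaves one inequality per [m]. *)
rewrite /eps /greedy_error sum_weighted_estimate mulr_suml mulr_sumr.
apply: ler_sum => m _; rewrite -scalerBr hnormZ mulrC.
(* The factor [|Fscal (Phi m)|] is moved last on the right so that it cancels from both sides. *)
rewrite -/Phi [X in CLip * X]mulrAC mulrA ler_wpM2r//.
apply: (le_trans (thetaL _ _ (VuNM m) (VuM m))); rewrite ler_wpM2l//.
exact: gpc_coef_error.
Qed.
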